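(* Let $\mathbf{m}\in\{0,\pm1\}^\infty$. Then $\mathbf{m}=\mathbf{m}^{\mathrm{abs}}_\le$ for some consistent cylinder order $\le$ on $\{0,\pm1\}^\infty$ with $0^\infty<1^\infty$ if and only if $\mathbf{m}=\sigma(\mathbf{m}_\preceq)$ for some $\sigma\in\{\varrho_0,\varrho_1,\varrho_2,\tau_{0,1}\}$ and some cylinder order $\preceq$ on $\{0,1\}^\infty$ with $0^\infty\prec1^\infty$. Moreover, let $\le$ be a consistent cylinder order on $\{0,\pm1\}^\infty$ with $0^\infty<1^\infty$. If $\mathbf{m}^{\mathrm{abs}}_\le=\sigma(\mathbf{m}_\preceq)$ for some $\sigma\in\{\varrho_0,\varrho_1,\varrho_2,\tau_{0,1}\}$ and some cylinder order $\preceq$ on $\{0,1\}^\infty$ with $0^\infty\prec1^\infty$, then (for the same $\sigma$) one can choose $\preceq$ to be the order given by: $\mathbf{a}\preceq\mathbf{b}$ if and only if $\sigma(\mathbf{a})\le\sigma(\mathbf{b})$ (that is, this is a cylinder order on $\{0,1\}^\infty$ with $0^\infty\prec1^\infty$ and it satisfies $\mathbf{m}^{\mathrm{abs}}_\le=\sigma(\mathbf{m}_\preceq)$), and with this choice $$\{\mathbf{a}\in\mathcal{M}^{\mathrm{abs}}_\le : \mathbf{a}<\mathbf{m}^{\mathrm{abs}}_\le\}=\{0^\infty\}\cup\{\sigma(\mathbf{a}) : \mathbf{a}\in\mathcal{M}_\preceq,\ \mathbf{a}\prec\mathbf{m}_\preceq\}.$$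
   Context: For a finite alphabet $A$, $A^\infty$ is the set of one-sided infinite words over $A$, with the ultrametric $d(a_1a_2\cdots,b_1b_2\cdots)=2^{-\min\{n\ge1 : a_n\ne b_n\}}$ for distinct words (and $d(\mathbf{a},\mathbf{a})=0$). A cylinder order on $A^\infty$ is a total order $\le$ such that $\mathbf{a}\le\mathbf{b}\le\mathbf{c}$ implies $d(\mathbf{a},\mathbf{b})\le d(\mathbf{a},\mathbf{c})$. The cylinder $[w]$ of a finite word $w$ is the set of infinite words with prefix $w$; for distinct $v,w$ of the same length, $[v]<[w]$ means $v^\infty<w^\infty$ (equivalently, every element of $[v]$ is smaller than every element of $[w]$). For a cylinder order $\preceq$ on $\{0,1\}^\infty$: $s_\preceq(a_1a_2\cdots)=\sup_{n\ge1}a_na_{n+1}\cdots$ (w.r.t. $\preceq$), $\mathcal{M}_\preceq=\{s_\preceq(\mathbf{a}):\mathbf{a}\in\{0,1\}^\infty\}$, and $\mathbf{m}_\preceq$ is the smallest (w.r.t. $\preceq$) accumulation point (w.r.t. $d$) of $\mathcal{M}_\preceq$. A cylinder order $\le$ on $\{0,\pm1\}^\infty$ is consistent if for each finite word $w\in\{0,\pm1\}^*$ we have $[w(-1)]<[w0]<[w1]$ or $[w(-1)]>[w0]>[w1]$. For $\mathbf{a}=a_1a_2\cdots\in\{0,\pm1\}^\infty$ let $-\mathbf{a}=(-a_1)(-a_2)\cdots$, and let $\mathrm{abs}(\mathbf{a})=\mathbf{a}$ if $\mathbf{a}\ge_{\mathrm{lex}}0^\infty$ and $\mathrm{abs}(\mathbf{a})=-\mathbf{a}$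 if $\mathbf{a}\le_{\mathrm{lex}}0^\infty$, where $\le_{\mathrm{lex}}$ is the lexicographic order with $-1<0<1$. For a cylinder order $\le$ on $\{0,\pm1\}^\infty$: $s^{\mathrm{abs}}_\le(a_1a_2\cdots)=\sup_{n\ge1}\mathrm{abs}(a_na_{n+1}\cdots)$ (w.r.t. $\le$), $\mathcal{M}^{\mathrm{abs}}_\le=\{s^{\mathrm{abs}}_\le(\mathbf{a}):\mathbf{a}\in\{0,\pm1\}^\infty\}$, and $\mathbf{m}^{\mathrm{abs}}_\le$ is the smallest (w.r.t. $\le$) accumulation point (w.r.t. $d$) of $\mathcal{M}^{\mathrm{abs}}_\le$. $\tau_{0,1}$ is the word morphism with $\tau_{0,1}(0)=1$, $\tau_{0,1}(1)=10$. For a finite word $w\in\{0,1\}^*$ let $|w|$ be its length and $|w|_i$ the number of occurrences of the letter $i$ in $w$. The maps $\varrho_0,\varrho_1,\varrho_2:\{0,1\}^*\to\{0,\pm1\}^*$ send the empty word to the empty word and are defined recursively, for $i\in\{0,1,2\}$, by: $\varrho_i(w0)=\varrho_i(w)\,1$ and $\varrho_i(w1)=\varrho_i(w)\,1\,0$ if $N_i(w)$ is even, and $\varrho_i(w0)=\varrho_i(w)\,(-1)$ and $\varrho_i(w1)=\varrho_i(w)\,(-1)\,0$ if $N_i(w)$ is odd, where $N_0(w)=|w|_0$, $N_1(w)=|w|_1$, $N_2(w)=|w|$. All these maps are extended naturally to infinite words. *)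

(* Defs.v *)
From HB Require Import structures.
From mathcomp Require Import all_boot all_order all_algebra.
From mathcomp Require Import boolp classical_sets functions.
From mathcomp Require Import topology.

Set Implicit Arguments.
Unset Strict Implicit.
Unset Printing Implicit Defensive.

Import Order.TTheory GRing.Theory Num.Theory.
Local Open Scope classical_set_scope.

(* Infinite words are indexed from 0: the letter a_n of a_1 a_2 ... is
   a (n - 1). *)
Definition word (A : Type) := nat -> A.

HB.instance Definition _ (A : choiceType) :=
  Choice.copy (word A) (nat -> A).

Definition shift (A : Type) (n : nat) (a : word A) : word A :=
  fun k => a (n + k)%N.

Section Distance.
Local Open Scope ring_scope.
Variable A : finType.
Implicit Types a b c : word A.

(* Distances are 0 or negative powers of 2, hence rational. The exponent is
   shifted by one because of the indexing from 0. *)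
Definition dist a b : rat :=
  if pselect (exists n, a n != b n) is left neq_ab
  then 2 ^- (ex_minn neq_ab).+1 else 0.

Lemma dist_leP a b k :
  reflect (forall i, (i < k)%N -> a i = b i) (dist a b <= 2 ^- k.+1).
Proof.
rewrite /dist; case: pselect => [neq_ab|eq_ab].
  case: ex_minnP => n ab_n n_min; rewrite lef_pV2 ?posrE ?exprn_gt0//.
  rewrite ler_eXn2l ?ltr1n// ltnS; apply: (iffP idP) => [le_kn i lt_ik|eq_k].
    by apply: contraTeq lt_ik => /n_min le_ni; rewrite -leqNgt (leq_trans le_kn).
  by rewrite leqNgt; apply: contra ab_n => /eq_k ->.
rewrite invr_ge0 exprn_ge0//; apply: ReflectT => i _.
by apply: contrapT => /eqP ab_i; apply: eq_ab; exists i.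
Qed.

Lemma dist_xx a : dist a a = 0.
Proof.
by rewrite /dist; case: pselect => // neq_aa; exfalso; case: neq_aa => n /eqP.
Qed.

Lemma dist_neq a b : a <> b -> exists k, dist a b = 2 ^- k.+1.
Proof.
rewrite /dist; case: pselect => [neq_ab _|eq_ab []]; first by eexists.
by apply/funext => i; apply: contrapT => /eqP ab_i; apply: eq_ab; exists i.
Qed.

Lemma dist_ge0 a b : 0 <= dist a b.
Proof. by rewrite /dist; case: pselect => // ?; rewrite invr_ge0 exprn_ge0. Qed.

Lemma dist_eq0 a b : dist a b = 0 -> a = b.
Proof.
move=> ab0; apply: contrapT => /dist_neq[k] /eqP; rewrite ab0.
by rewrite lt_eqF ?invr_gt0 ?exprn_gt0.
Qed.

Lemma dist_sym a b : dist a b = dist b a.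
Proof.
suff le_dist x y : dist x y <= dist y x by apply/le_anti; rewrite !le_dist.
have [->//|/dist_neq[k yx_k]] := pselect (y = x).
have /dist_leP eq_k : dist y x <= 2 ^- k.+1 by rewrite yx_k.
by rewrite yx_k; apply/dist_leP => i /eq_k.
Qed.

Lemma dist_ultra b a c : dist a c <= Num.max (dist a b) (dist b c).
Proof.
have [->|neq_ab] := pselect (a = b); first by rewrite le_max lexx orbT.
have [<-|neq_bc] := pselect (b = c); first by rewrite le_max lexx.
have [k max_k] : exists k, Num.max (dist a b) (dist b c) = 2 ^- k.+1.
  by case: leP => _; apply: dist_neq.
have : Num.max (dist a b) (dist b c) <= 2 ^- k.+1 by rewrite max_k.
rewrite ge_max => /andP[/dist_leP ab /dist_leP bc].
by rewrite max_k; apply/dist_leP => i ik; rewrite ab ?bc.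
Qed.

Lemma dist_triangle b a c : dist a c <= dist a b + dist b c.
Proof.
by apply: le_trans (dist_ultra b a c) _; rewrite ge_max lerDl lerDr !dist_ge0.
Qed.

HB.instance Definition _ := isMetric.Build rat (word A)
  dist_xx dist_eq0 dist_sym dist_triangle.

End Distance.

(* An order is given by its (boolean) relation "less than or equal to". *)
Section Orders.
Variable A : finType.
Implicit Types (le : rel (word A)) (X : set (word A)).

Definition total_order le := [/\ antisymmetric le, transitive le & total le].

Definition cylinder_order le :=
  total_order le /\
  forall a b c, le a b -> le b c -> (mdist a b <= mdist a c)%R.

Definition strict le : rel (word A) := fun a b => le a b && (a != b).

(* The default value x0 is irrelevant for a cylinder order and a nonempty
   closed X, where the least element exists by compactness. *)
Definition least (x0 : word A) le X : word A :=
  xget x0 [set x | X x /\ forall y, X y -> le x y].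

Definition sup_word (x0 : word A) le X : word A :=
  least x0 le [set u | forall x, X x -> le x u].

End Orders.

(* Binary words: false is the letter 0 and true the letter 1. *)

Definition sup_shifts (le : rel (word bool)) (a : word bool) : word bool :=
  sup_word a le [set shift n a | n in setT].

Definition Mset (le : rel (word bool)) : set (word bool) :=
  range (sup_shifts le).

Definition mword (le : rel (word bool)) : word bool :=
  least (cst false) le (limit_point (Mset le)).

Inductive trit := Tm1 | T0 | T1.

Definition trit_int (x : trit) : int :=
  match x with Tm1 => (-1)%R | T0 => 0%R | T1 => 1%R end.

Definition trit_ord (x : trit) : 'I_3 :=
  match x with Tm1 => inord 0 | T0 => inord 1 | T1 => inord 2 end.

Definition ord_trit (i : 'I_3) : trit := nth T0 [:: Tm1; T0; T1] i.

Lemma trit_ordK : cancel trit_ord ord_trit.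
Proof. by case; rewrite /ord_trit /= inordK. Qed.

HB.instance Definition _ := Countable.copy trit (can_type trit_ordK).
HB.instance Definition _ := isFinite.Build trit (pcan_enumP (can_pcan trit_ordK)).

Definition opp_trit (x : trit) : trit :=
  match x with Tm1 => T1 | T0 => T0 | T1 => Tm1 end.

Definition opp_word (a : word trit) : word trit := fun n => opp_trit (a n).

Definition lex_lt (a b : word trit) : Prop :=
  exists n, (forall k, (k < n)%N -> a k = b k) /\
            (trit_int (a n) < trit_int (b n))%R.

Definition lex_le (a b : word trit) : Prop := a = b \/ lex_lt a b.

Definition abs_word (a : word trit) : word trit :=
  if pselect (lex_le (cst T0) a) then a else opp_word a.

Definition sup_abs_shifts (le : rel (word trit)) (a : word trit) : word trit :=
  sup_word a le [set abs_word (shift n a) | n in setT].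

Definition Mset_abs (le : rel (word trit)) : set (word trit) :=
  range (sup_abs_shifts le).

Definition mword_abs (le : rel (word trit)) : word trit :=
  least (cst T0) le (limit_point (Mset_abs le)).

(* The infinite word w w w ..., for nonempty w. *)
Definition omega (w : seq trit) : word trit :=
  fun n => nth T0 w (n %% size w).

(* [v] < [w], for distinct words v and w of the same length. *)
Definition cyl_lt (le : rel (word trit)) (v w : seq trit) : bool :=
  strict le (omega v) (omega w).

Definition consistent (le : rel (word trit)) : Prop :=
  forall w : seq trit,
    (cyl_lt le (rcons w Tm1) (rcons w T0) /\
     cyl_lt le (rcons w T0) (rcons w T1)) \/
    (cyl_lt le (rcons w T0) (rcons w Tm1) /\
     cyl_lt le (rcons w T1) (rcons w T0)).

Definition tau01 (w : seq bool) : seq trit :=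
  flatten [seq if x then [:: T1; T0] else [:: T1] | x <- w].

(* The block appended to the image of w when the letter x is appended to w;
   the parity of N w determines the sign. *)
Definition rho_block (N : seq bool -> nat) (w : seq bool) (x : bool) :
    seq trit :=
  let e := if odd (N w) then Tm1 else T1 in
  if x then [:: e; T0] else [:: e].

(* The argument is reversed: its head is the last letter of the word. *)
Fixpoint rho_rev (N : seq bool -> nat) (r : seq bool) : seq trit :=
  if r is x :: r' then rho_rev N r' ++ rho_block N (rev r') x else [::].

Definition rho (N : seq bool -> nat) (w : seq bool) : seq trit :=
  rho_rev N (rev w).

Lemma rho_nil N : rho N [::] = [::].
Proof. by []. Qed.

Lemma rho_rcons N w x : rho N (rcons w x) = rho N w ++ rho_block N w x.
Proof. by rewrite /rho rev_rcons /= revK. Qed.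

Definition rho0 := rho (count_mem false).
Definition rho1 := rho (count_mem true).
Definition rho2 := rho size.

Definition substitutions : set (seq bool -> seq trit) :=
  [set rho0; rho1; rho2; tau01].

(* The value at n is read off the image of the prefix of length n + 1; this is
   meaningful for maps f such that f w is a prefix of f (w x) of length at
   least that of w, see [extend_prefix]. *)
Definition extend (f : seq bool -> seq trit) (a : word bool) : word trit :=
  fun n => nth T0 (f (mkseq a n.+1)) n.

Lemma substitutions_rcons f w x : substitutions f ->
  exists2 u, f (rcons w x) = f w ++ u & (0 < size u)%N.
Proof.
have rhoP N : exists2 u, rho N (rcons w x) = rho N w ++ u & (0 < size u)%N.
  by exists (rho_block N w x); [exact: rho_rcons|case: (x)].
case=> [[[]|]|] ->; [exact: rhoP..|].
exists (if x then [:: T1; T0] else [:: T1]); last by case: (x).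
by rewrite /tau01 map_rcons flatten_rcons.
Qed.

Lemma extend_prefix f (a : word bool) n : substitutions f ->
  mkseq (extend f a) (size (f (mkseq a n))) = f (mkseq a n).
Proof.
move=> f_sub; have mkS k : mkseq a k.+1 = rcons (mkseq a k) (a k) by exact: mkseqS.
have f_size k : (k <= size (f (mkseq a k)))%N.
  elim: k => // k IHk; rewrite mkS.
  have [u -> u_gt0] := substitutions_rcons (mkseq a k) (a k) f_sub.
  by rewrite size_cat -addn1 leq_add.
have f_nth k d i : (i < size (f (mkseq a k)))%N ->
    nth T0 (f (mkseq a (k + d))) i = nth T0 (f (mkseq a k)) i
    /\ (i < size (f (mkseq a (k + d))))%N.
  move=> lt_i; elim: d => [|d [IHd lt_d]]; first by rewrite addn0.
  rewrite addnS mkS.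
  have [u -> _] := substitutions_rcons (mkseq a (k + d)) (a (k + d)) f_sub.
  by rewrite nth_cat lt_d size_cat ltn_addr.
apply: (@eq_from_nth _ T0) => [|i]; rewrite size_mkseq // => lt_i.
rewrite nth_mkseq // /extend.
by rewrite -(f_nth i.+1 n i (f_size _)).1 addnC (f_nth n i.+1 i lt_i).1.
Qed.

(* Main.v *)
Require Import Defs.
From mathcomp Require Import all_boot all_order all_algebra.
From mathcomp Require Import boolp classical_sets functions topology.
Local Open Scope classical_set_scope.

Set Implicit Arguments.
Unset Strict Implicit.
Unset Printing Implicit Defensive.
Import Order.TTheory GRing.Theory Num.Theory.

(** The four substitutions are one construction. Reading a binary word, write
    the current sign, followed by [T0] when the letter is 1, and flip the sign
    after each letter [x] with [p x]. The four choices of [p : pred bool] give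
    rho_0, rho_1, rho_2 and tau_{0,1} ([substitutionsE]); so [sigma p] stands
    for the substitution from here on.

    A consistent order with 0^oo < 1^oo determines [p]. A nonzero word of the
    spectrum M^abs starts with 1, and the small ones are those whose initial 1
    is followed by the smallest possible letters. Consistency says that the
    smallest letter after 1 is -1 or 1, and similarly after 10. Let [p false]
    hold when it is -1 after 1, and [p true] when it is -1 after 10
    ([adapted], [consistent_adapted]). If [m] in M^abs starts with 1 and this
    smallest letter, or with 10 and this smallest letter ([low]), then the same
    must hold, up to sign, at every nonzero letter of [m], since the absolute
    values of the shifts are at most [m]; this means exactly that [m] is
    [sigma p a] for some [a] ([Mset_abs_low]). All the images of [sigma p] are
    low, and a word of M^abs starting with 1 that is not low is above all of
    them ([low_le]). Moreover the absolute values of the shifts of [sigma p a]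
    are the images of the shifts of [a], and words starting with 0, so that
    [sigma p a] is in M^abs if and only if [a] is in the spectrum M of the
    pulled back order ([Mset_pullback]). Hence the bottom of M^abs is 0^oo
    followed by a copy of M, which yields both the formula for m^abs
    ([mword_abs_pullback]) and the description of what lies below it
    ([Mset_abs_below]). This uses that M has an accumulation point: for each
    order, all the words (1 0^k)^oo are in M, and they converge to 1 0^oo.

    The same sequence shows that the least accumulation point [m] of M starts
    with 10 ([mword_head]). The next letters of [sigma p m] then reveal [p true] and [p false]
    ([sigma_determines]), so m^abs is an image under at most one of the four
    substitutions.

    Conversely, a consistent order amounts to choosing, for each finite word,
    whether the three letters that may follow it are increasing or decreasing
    ([sign_le]). The words [sigma p a] and [sigma p b] separate just after a
    nonzero letter, where one has 0 and the other has a nonzero letter, so any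
    binary cylinder order can be prescribed on the image of [sigma p]
    ([pullback_extension]); the direction after 10 remains free, and is chosen
    so that the order leads back to [p] ([extension_adapted]). *)

(** * Agreement of words up to a position *)

Section Words.
Variable A : finType.
Implicit Types (a b c x y z : word A) (le : rel (word A)) (X : set (word A)).

Definition agree n a b := forall i, (i < n)%N -> a i = b i.

Lemma agree_refl n a : agree n a a. Proof. by []. Qed.

Lemma agree_sym n a b : agree n a b -> agree n b a.
Proof. by move=> ab i /ab. Qed.

Lemma agree_trans n b a c : agree n a b -> agree n b c -> agree n a c.
Proof. by move=> ab bc i lt_in; rewrite ab ?bc. Qed.

Lemma agree_le n m a b : (m <= n)%N -> agree n a b -> agree m a b.
Proof. by move=> le_mn ab i lt_im; apply: ab; apply: leq_trans le_mn. Qed.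

Lemma agreeS n a b : agree n a b -> a n = b n -> agree n.+1 a b.
Proof. by move=> ab abn i; rewrite ltnS leq_eqVlt => /predU1P[->|/ab]. Qed.

Lemma agree_eq a b : (forall n, agree n a b) -> a = b.
Proof. by move=> ab; apply/funext => i; apply: (ab i.+1). Qed.

Lemma first_difference a b :
  a <> b -> exists2 n, agree n a b & a n <> b n.
Proof.
move=> neq_ab; have ex_ab : exists n, a n != b n.
  apply: contrapT => eq_ab; apply: neq_ab; apply/funext => n.
  by apply: contrapT => /eqP ab_n; apply: eq_ab; exists n.
exists (ex_minn ex_ab); case: ex_minnP => n ab_n min_n; last exact/eqP.
by move=> i lt_in; apply/eqP; apply: contraLR lt_in => /min_n; rewrite -leqNgt.
Qed.

Lemma agree_mkseq n a b : agree n a b <-> mkseq a n = mkseq b n.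
Proof.
split=> [ab|eq_ab i lt_in].
  by apply/eq_in_map => i; rewrite mem_iota /= => /ab.
by rewrite -(nth_mkseq (a 0%N) a lt_in) eq_ab nth_mkseq.
Qed.

Lemma limit_point_agree X x :
  limit_point X x <-> forall n, exists y, [/\ y <> x, X y & agree n x y].
Proof.
split=> [lim_x n|lim_x U].
  have /lim_x [y [/eqP neq_yx Xy xy]] : nbhs x [set y | agree n x y].
    apply/nbhs_ballP; exists (2 ^- n.+1)%R => /=.
      by rewrite invr_gt0 exprn_gt0.
    by move=> y; rewrite ballEmdist /= => /ltW /dist_leP.
  by exists y.
rewrite nbhs_ballP => -[e /= e_gt0 xe_U].
have [n lt_ne] : exists n, (2 ^- n.+1 < e :> rat)%R.
  exists (Num.bound e^-1)%R; rewrite invf_plt ?posrE ?exprn_gt0 //.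
  apply: lt_le_trans (archi_boundP _) _; first by rewrite invr_ge0 ltW.
  by rewrite -natrX ler_nat; apply: ltnW; apply: ltnW; apply: ltn_expl.
have [y [neq_yx Xy xy]] := lim_x n; exists y; split=> //; first exact/eqP.
by apply: xe_U; rewrite ballEmdist /=; apply: le_lt_trans lt_ne; apply/dist_leP.
Qed.

(** Topological closedness, in terms of prefixes. *)
Definition seq_closed X :=
  forall x, (forall n, exists2 y, X y & agree n x y) -> X x.

Lemma seq_closed_limit_point X : seq_closed (limit_point X).
Proof.
move=> x lim_x; apply/limit_point_agree => n.
have [y lim_y xy] := lim_x n.
have [[k yx_k neq_yx]|eq_yx] := pselect (exists2 k, agree k y x & y k <> x k);
    last first.
  have [z [neq_zy Xz yz]] := (limit_point_agree X y).1 lim_y n.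
  exists z; split=> // [eq_zx|]; last exact: agree_trans yz.
  apply: eq_yx; apply: first_difference; congruence.
have [z [neq_zy Xz yz]] := (limit_point_agree X y).1 lim_y (maxn n k.+1).
exists z; split=> // [eq_zx|].
  by apply: neq_yx; rewrite -eq_zx; apply: yz; rewrite leq_maxr.
by apply: agree_trans xy _; apply: agree_le yz; rewrite leq_maxl.
Qed.

(** * Cylinder orders and least elements of closed sets *)

Section CylinderOrder.
Variable le : rel (word A).
Hypothesis cyl : cylinder_order le.

Lemma cyl_anti a b : le a b -> le b a -> a = b.
Proof. by move=> ab ba; case: cyl => -[anti _ _] _; apply: anti; rewrite ab. Qed.

Lemma cyl_trans b a c : le a b -> le b c -> le a c.
Proof. by case: cyl => -[_ tr _] _; apply: tr. Qed.

Lemma cyl_total a b : le a b \/ le b a.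
Proof. by case: cyl => -[_ _ tot] _; apply/orP; apply: tot. Qed.

Lemma cyl_refl a : le a a. Proof. by case: (cyl_total a a). Qed.

(** Seen on prefixes, the metric condition says that cylinders are convex. *)
Lemma cyl_convex n a b c : le a b -> le b c -> agree n a c -> agree n a b.
Proof.
move=> ab bc /dist_leP ac; apply/dist_leP; apply: le_trans ac.
by case: cyl => _; apply.
Qed.

(** As disjoint cylinders are convex, each of them lies on one side of the
    other: a comparison depends only on prefixes long enough to differ. *)
Lemma cyl_agree n a b a' b' :
  ~ agree n a b -> agree n a a' -> agree n b b' -> le a b -> le a' b'.
Proof.
move=> nab aa' bb' ab; have a'b : le a' b.
  by case: (cyl_total a' b) => // ba'; case: nab; apply: cyl_convex ba' aa'.
case: (cyl_total a' b') => // b'a'; case: nab.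
apply: agree_trans aa' (agree_trans _ (agree_sym bb')).
apply/agree_sym; apply: cyl_convex b'a' a'b _; exact: agree_sym.
Qed.

Lemma cyl_negb a b : a <> b -> le a b = ~~ le b a.
Proof.
move=> neq_ab; apply/idP/negP => [ab ba|nba]; first exact/neq_ab/cyl_anti.
by case: (cyl_total a b).
Qed.

(** The order relation is closed: this is how comparisons pass to limits. *)
Lemma cyl_closed n a b a' b' : a' n <> b' n ->
  agree n.+1 a a' -> agree n.+1 b b' -> le a b -> le a' b'.
Proof.
move=> neq_n aa' bb'; apply: (cyl_agree (n := n.+1)) => // ab; apply: neq_n.
by rewrite -aa' // -bb' // ab.
Qed.

Lemma seq_min (s : seq (word A)) : s != [::] ->
  exists2 x, x \in s & forall y, y \in s -> le x y.
Proof.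
elim: s => [//|y s IHs] _; have [->|/IHs [x xs x_min]] := eqVneq s [::].
  by exists y; rewrite ?mem_head // => z; rewrite inE => /eqP ->; apply: cyl_refl.
case: (cyl_total x y) => [le_xy|le_yx].
  exists x => [|z]; first by rewrite inE xs orbT.
  by rewrite inE => /predU1P[->|/x_min].
exists y => [|z]; first exact: mem_head.
rewrite inE => /predU1P[->|/x_min]; first exact: cyl_refl.
exact: cyl_trans.
Qed.

(** There are finitely many cylinders of words of length [n], hence a lowest one
    among those that meet the set. *)
Lemma least_upto X n : X !=set0 ->
  exists2 x, X x & forall y, X y -> agree n x y \/ le x y.
Proof.
case=> x0 Xx0.
pose repr (t : n.-tuple A) : word A := xget x0 [set x | X x /\ mkseq x n = t].
have reprX t : X (repr t) by rewrite /repr; case: xgetP => [x _ []|].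
have repr_agree y : X y -> agree n (repr [tuple of mkseq y n]) y.
  move=> Xy; apply/agree_mkseq; rewrite /repr; case: xgetP => [x _ [] //|].
  by move=> /(_ y) [].
have [|x /mapP[t _ ->] x_min] := @seq_min [seq repr t | t <- enum {: n.-tuple A}].
  rewrite -size_eq0 size_map -cardE; apply/negP => /eqP/card0_eq.
  by move=> /(_ [tuple of mkseq x0 n]).
exists (repr t) => // y Xy.
have [ty|nty] := pselect (agree n (repr t) y); [by left|right].
have le_tz : le (repr t) (repr [tuple of mkseq y n]).
  by apply: x_min; apply: map_f; rewrite mem_enum.
apply: (cyl_agree _ (@agree_refl n _) (repr_agree _ Xy)) le_tz.
by move=> /agree_trans /(_ (repr_agree _ Xy)).
Qed.

(** The lowest cylinders meeting the set are nested, because they are lowest,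
    and their common point is the least element. *)
Lemma least_exists X : seq_closed X -> X !=set0 ->
  exists2 x, X x & forall y, X y -> le x y.
Proof.
move=> clX nzX.
have /choice[u uP] n : exists x, X x /\ forall y, X y -> agree n x y \/ le x y.
  by have [x Xx x_min] := least_upto n nzX; exists x.
have u_coh n m : (n <= m)%N -> agree n (u n) (u m).
  move=> le_nm; case: (uP n) (uP m) => Xn un [Xm um].
  case: (un _ Xm) => // le_n; case: (um _ Xn) => [/(agree_le le_nm)/agree_sym //|].
  by move=> /(cyl_anti le_n) <-.
pose x := fun n => u n.+1 n.
have x_agree n : agree n x (u n).
  by move=> i lt_in; rewrite /x; apply: (u_coh i.+1).
exists x.
  by apply: clX => n; exists (u n); [case: (uP n)|].
move=> y Xy; have [<-|/first_difference[n xy neq_xy]] := pselect (x = y).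
  exact: cyl_refl.
have nuy : ~ agree n.+1 (u n.+1) y.
  by move=> /(_ n (ltnSn n)); rewrite -x_agree.
case: (uP n.+1) => _ /(_ _ Xy) [//|].
apply: cyl_agree nuy _ _ => //; exact: agree_sym.
Qed.

Lemma leastP x0 X : seq_closed X -> X !=set0 ->
  X (least x0 le X) /\ forall y, X y -> le (least x0 le X) y.
Proof.
move=> clX nzX; rewrite /least; case: xgetP => [x _ //|none].
by have [x Xx x_min] := least_exists clX nzX; case: (none x).
Qed.

Lemma least_eq x0 X x : X x -> (forall y, X y -> le x y) -> least x0 le X = x.
Proof.
move=> Xx x_min; rewrite /least; case: xgetP => [y _ [Xy y_min]|/(_ x) []] //.
by apply: cyl_anti; [apply: y_min|apply: x_min].
Qed.

End CylinderOrder.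

(** The converse of [cyl_convex]. *)
Lemma cylinder_order_agree le :
  (forall a b, le a b -> le b a -> a = b) -> transitive le -> total le ->
  (forall n a b c, le a b -> le b c -> agree n a c -> agree n a b) ->
  cylinder_order le.
Proof.
move=> anti tr tot convex; split; first split=> //.
  by move=> a b /andP[]; apply: anti.
move=> a b c ab bc; have [eq_ac|/dist_neq[k ac_k]] := pselect (a = c).
  by rewrite -eq_ac in bc *; rewrite (anti _ _ ab bc).
have ac : agree k a c by apply/dist_leP; rewrite ac_k.
by rewrite /mdist /= ac_k; apply/dist_leP; apply: convex ab bc ac.
Qed.

Lemma rev_cylinder_order le :
  cylinder_order le -> cylinder_order (fun a b => le b a).
Proof.
move=> cyl; apply: cylinder_order_agree.
- by move=> a b ba ab; apply: (cyl_anti cyl).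
- by move=> b a c ba cb; apply: (cyl_trans cyl) ba.
- by move=> a b; apply/orP; apply: (cyl_total cyl).
move=> n a b c ba cb ac; apply: agree_trans (ac) _.
exact: (cyl_convex cyl cb ba (agree_sym ac)).
Qed.

(** * Suprema of orbits *)

Definition adherence X : set (word A) :=
  [set x | forall n, exists2 y, X y & agree n x y].

Lemma seq_closed_adherence X : seq_closed (adherence X).
Proof.
move=> x adh_x n; have [y /(_ n) [z Xz yz] xy] := adh_x n.
by exists z => //; apply: agree_trans yz.
Qed.

Lemma seq_closed_below le a : cylinder_order le -> seq_closed [set x | le x a].
Proof.
move=> cyl x lim_x /=; have [->|/first_difference[n _ neq_n]] := pselect (x = a).
  exact: cyl_refl.
have [y ya /agree_sym xy] := lim_x n.+1.
exact: (cyl_closed cyl neq_n xy (@agree_refl _ _)).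
Qed.

Section Sup.
Variable le : rel (word A).
Hypothesis cyl : cylinder_order le.

Lemma sup_word_eq x0 X x : X x -> (forall y, X y -> le y x) ->
  sup_word x0 le X = x.
Proof. by move=> Xx x_max; apply: (least_eq cyl) => // u; apply. Qed.

(** The supremum is the greatest element of the adherence: upper bounds of the
    set are upper bounds of its adherence, as the order is closed. *)
Lemma sup_word_adherence x0 X : X !=set0 ->
  adherence X (sup_word x0 le X) /\ forall y, X y -> le y (sup_word x0 le X).
Proof.
move=> [z Xz]; have subX y : X y -> adherence X y by move=> Xy n; exists y.
have [|x adh_x x_max] :=
  least_exists (rev_cylinder_order cyl) (@seq_closed_adherence X).
  by exists z; apply: subX.
have -> : sup_word x0 le X = x; last by split=> // y /subX /x_max.
apply: (least_eq cyl) => [y /subX /x_max //|u u_ub].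
apply: (seq_closed_below cyl) => n; have [y Xy xy] := adh_x n.
by exists y; first exact: u_ub.
Qed.

Section SupOrbit.
Variable F : nat -> word A -> word A.
Hypothesis F_comp : forall i j a, F j (F i a) = F (i + j) a.
Hypothesis F_agree : forall j n a b,
  agree (j + n) a b -> agree n (F j a) (F j b).

Definition sup_orbits : set (word A) :=
  range (fun a => sup_word a le [set F n a | n in setT]).

(** The family [F] stands for the shifts, and for the absolute values of the
    shifts. A supremum is a limit of words [F i a], so that [F j] maps it to a
    limit of words [F (i + j) a], which are below the supremum. Conversely a
    word that dominates its own orbit is its own supremum. *)
Lemma sup_orbitsP m :
  sup_orbits m <-> F 0 m = m /\ forall j, le (F j m) m.
Proof.
split=> [[a _ <-]|[F0m Fm]]; last first.
  exists m => //; apply: sup_word_eq => [|_ [j _ <-] //].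
  by exists 0%N.
have [|] := @sup_word_adherence a [set F n a | n in setT].
  by exists (F 0 a); exists 0%N.
move: (sup_word _ _ _) => {}m adh_m m_ub; split=> [|j].
  apply: agree_eq => n; have [_ [i _ <-] mi] := adh_m n.
  apply: agree_trans (agree_sym mi); rewrite -[i]addn0 -F_comp.
  exact: F_agree.
have [->|/first_difference[n _ neq_n]] := pselect (F j m = m).
  exact: cyl_refl.
have [_ [i _ <-] mi] := adh_m (j + n.+1)%N.
apply: (cyl_closed cyl neq_n (a := F (i + j) a) _ (@agree_refl _ _)).
  by rewrite -F_comp; apply: F_agree; apply: agree_sym.
by apply: m_ub; exists (i + j)%N.
Qed.

Lemma seq_closed_sup_orbits : seq_closed sup_orbits.
Proof.
move=> m lim_m; apply/sup_orbitsP; split=> [|j].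
  apply: agree_eq => n; have [x /sup_orbitsP[F0x _] mx] := lim_m n.
  by apply: agree_trans (agree_sym mx); rewrite -F0x; exact: F_agree.
have [->|/first_difference[n _ neq_n]] := pselect (F j m = m).
  exact: cyl_refl.
have [x /sup_orbitsP[_ Fx] mx] := lim_m (j + n.+1)%N.
apply: (cyl_closed cyl neq_n _ _ (Fx j)).
  by apply: F_agree; apply: agree_sym.
by apply: agree_le (agree_sym mx); rewrite leq_addl.
Qed.

End SupOrbit.
End Sup.
End Words.

(** * Cylinder orders on binary words *)

Lemma shift_comp (A : Type) i j (a : word A) :
  shift j (shift i a) = shift (i + j) a.
Proof. by apply/funext => k; rewrite /shift addnA. Qed.

Lemma agree_shift (A : finType) j n (a b : word A) :
  agree (j + n) a b -> agree n (shift j a) (shift j b).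
Proof. by move=> ab i lt_in; rewrite /shift ab // ltn_add2l. Qed.

Section BinaryOrder.
Variable prec : rel (word bool).
Hypothesis cyl : cylinder_order prec.

Lemma MsetP a : Mset prec a <-> forall j, prec (shift j a) a.
Proof.
have Ma := sup_orbitsP cyl (@shift_comp bool) (@agree_shift bool) a.
by apply: (iff_trans Ma); split=> [[]|].
Qed.

Lemma seq_closed_Mset : seq_closed (Mset prec).
Proof.
exact: (seq_closed_sup_orbits cyl (@shift_comp bool) (@agree_shift bool)).
Qed.

Hypothesis prec01 : strict prec (cst false) (cst true).

Lemma prec_head a b : a 0 = false -> b 0 = true -> prec a b.
Proof.
move=> a0 b0; have /andP[le01 _] := prec01.
apply: (cyl_agree cyl (n := 1) _ _ _ le01) => [/(_ 0 isT) //||] i;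
  by rewrite ltnS leqn0 => /eqP ->.
Qed.

(** A letter 1 somewhere would give a shift above the word. *)
Lemma Mset_head0 a : Mset prec a -> a 0 = false -> a = cst false.
Proof.
move=> /MsetP Ma a0; apply/funext => j; apply/negbTE/negP => aj.
have eq_a : shift j a = a.
  by apply: (cyl_anti cyl) => //; apply: prec_head; rewrite // /shift addn0.
by move: a0; rewrite -eq_a /shift addn0 aj.
Qed.

(** The word (1 0^(k-1))^oo; [one_zeros] is its limit 1 0^oo. *)
Definition one_every k : word bool := fun n => n %% k == 0.
Definition one_zeros : word bool := fun n => n == 0.

(** A shift of a periodic word with a single 1 in its period is the word itself
    or starts with 0, and the latter is smaller in every order with 0 < 1. *)
Lemma Mset_one_every k : Mset prec (one_every k.+1).
Proof.
apply/MsetP => j; have [dvd_kj|ndvd_kj] := boolP (k.+1 %| j).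
  suff -> : shift j (one_every k.+1) = one_every k.+1 by apply: cyl_refl.
  by apply/funext => n; rewrite /shift /one_every -modnDml (eqP dvd_kj).
apply: prec_head; rewrite // /shift /one_every addn0.
exact: negbTE.
Qed.

Lemma limit_point_one_zeros : limit_point (Mset prec) one_zeros.
Proof.
apply/limit_point_agree => n; exists (one_every n.+1); split=> [|//|i lt_in].
- by move=> /(congr1 (fun a => a n.+1)); rewrite /one_every /one_zeros modnn.
- exact: Mset_one_every.
- by rewrite /one_every /one_zeros modn_small // ltnW.
Qed.

Lemma mwordP : limit_point (Mset prec) (mword prec) /\
  forall a, limit_point (Mset prec) a -> prec (mword prec) a.
Proof.
apply: (leastP cyl); first exact: seq_closed_limit_point.
by exists one_zeros; apply: limit_point_one_zeros.
Qed.

Lemma Mset_mword : Mset prec (mword prec).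
Proof.
apply: seq_closed_Mset => n; have [lim _] := mwordP.
have [y [_ My my]] := (limit_point_agree _ _).1 lim n.
by exists y.
Qed.

(** If the cylinder [10] is below [11], then so is the least accumulation point,
    as it is at most 1 0^oo. If it is above, then 1^oo is the only word of the
    spectrum in [11], so there is no accumulation point in [11]. *)
Lemma mword_head : mword prec 0 = true /\ mword prec 1 = false.
Proof.
have [lim m_min] := mwordP; have Mm := Mset_mword.
have near := (limit_point_agree _ _).1 lim.
have m0 : mword prec 0 = true.
  apply: contrapT => /negP /negbTE m0.
  have [y [neq_ym My my]] := near 1; case: neq_ym.
  by rewrite (Mset_head0 Mm m0) (Mset_head0 My) // -my.
split=> //; apply/negbTE/negP => m1.
(* m is below 1 0^oo, so a first comparison of [11] with [10] decides all *)
have le11 (a b : word bool) : a 0 -> a 1 -> b 0 -> ~~ b 1 -> prec a b.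
  move=> a0 a1 b0 /negbTE b1.
  apply: (cyl_agree cyl (n := 2) _ _ _ (m_min _ limit_point_one_zeros)).
  - by move=> /(_ 1 isT); rewrite m1.
  - by case=> [|[]] //; rewrite ?m0 ?m1.
  - by case=> [|[]] //; rewrite ?b0 ?b1.
have ones (y : word bool) : Mset prec y -> y 0 -> y 1 -> y = cst true.
  move=> /MsetP My y0 y1; apply: contrapT => /first_difference[k yk neq_k].
  case: k => [|k] in yk neq_k *; first by rewrite y0 in neq_k.
  have /negbTE yk1 : ~~ y k.+1 by apply/negP => yk1; rewrite yk1 in neq_k.
  have yk0 : y k by rewrite yk.
  have eq_y : shift k y = y.
    apply: (cyl_anti cyl) => //.
    by apply: le11; rewrite // /shift ?addn0 // addn1 yk1.
  by move: y1; rewrite -eq_y /shift addn1 yk1.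
have [y [neq_ym My my]] := near 2; case: neq_ym.
rewrite (ones (mword prec) Mm m0 m1).
by apply: ones My _ _; [rewrite -(my 0 isT) m0|rewrite -(my 1 isT)].
Qed.

End BinaryOrder.

(** * Signs and absolute values of ternary words *)

(** Signs are booleans, [true] being the sign -1, so that the product of signs is
    the exclusive or. *)
Definition signed (s : bool) (x : trit) : trit := if s then opp_trit x else x.

Definition sgn (s : bool) : trit := signed s T1.

Definition signed_word (s : bool) (x : word trit) : word trit :=
  fun n => signed s (x n).

Lemma signedD s t x : signed s (signed t x) = signed (s (+) t) x.
Proof. by case: s; case: t; case: x. Qed.

Lemma signed_wordD s t x :
  signed_word s (signed_word t x) = signed_word (s (+) t) x.
Proof. by apply/funext => n; apply: signedD. Qed.

Lemma signed_eq0 s x : (signed s x == T0) = (x == T0).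
Proof. by apply/eqP/eqP; case: s; case: x. Qed.

Lemma sgn_eq0 s : (sgn s == T0) = false.
Proof. by apply/eqP; case: s. Qed.

Lemma sgn_inj : injective sgn. Proof. by move=> [] []. Qed.

Lemma neq0_sgn x : x <> T0 -> x = sgn (x == Tm1).
Proof. by case: eqP => [->|]; case: x. Qed.

Lemma trit_cases s (x : trit) : [\/ x = T0, x = sgn s | x = sgn (~~ s)].
Proof.
by case: x; case: s; first [by constructor 1|by constructor 2|by constructor 3].
Qed.

(** A word is nonnegative when its first nonzero letter, if any, is 1. *)
Lemma lex_le0P x : lex_le (cst T0) x <->
  forall k, (forall i, (i < k)%N -> x i = T0) -> x k <> Tm1.
Proof.
split=> [[<- //|[n [x0 xn]]] k xk|x_pos].
  case: (ltngtP k n) => [/x0 <- //|/xk eq_xn|->].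
    by rewrite eq_xn in xn.
  by move=> eq_xn; rewrite eq_xn in xn.
have [->|/first_difference[n xn neq_n]] := pselect (x = cst T0); first by left.
right; exists n; split=> [k /xn //|].
by move: neq_n (x_pos n xn) => /=; case: (x n).
Qed.

Lemma abs_wordP x : lex_le (cst T0) (abs_word x) /\
  exists s, abs_word x = signed_word s x.
Proof.
rewrite /abs_word; case: pselect => [x_pos|x_neg] /=.
  by split=> //; exists false; apply/funext.
split; last by exists true.
apply: contrapT => x_pos; apply: x_neg; apply/lex_le0P => k xk xk_neg.
apply: x_pos; apply/lex_le0P => k' xk'.
have x0 i : (i < k')%N -> x i = T0.
  by move=> /xk'; rewrite /opp_word; case: (x i).
case: (ltngtP k k') => [/x0|/xk|<-]; rewrite /opp_word.
- by rewrite xk_neg.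
- by move=> ->.
- by rewrite xk_neg.
Qed.

(** If [x] and [y] share a prefix and need opposite signs to become
    nonnegative, then this prefix contains only zeros. This is what makes the
    absolute value well defined and continuous, also at 0^oo. *)
Lemma lex_le0_agree n x y s t :
  lex_le (cst T0) (signed_word s x) -> lex_le (cst T0) (signed_word t y) ->
  agree n x y -> agree n (signed_word s x) (signed_word t y).
Proof.
have [<- _ _ xy i lt_in|] := eqVneq s t; first by rewrite /signed_word xy.
move=> neq_st /lex_le0P x_pos /lex_le0P y_pos xy.
suff x0 i : (i < n)%N -> x i = T0.
  by move=> i lt_in; rewrite /signed_word -xy // x0 //; case: (s); case: (t).
elim/ltn_ind: i => i IHi lt_in.
have x0 j : (j < i)%N -> x j = T0.
  by move=> lt_ji; apply: IHi => //; apply: ltn_trans lt_in.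
have := x_pos i; have := y_pos i; rewrite /signed_word -xy //.
case: (s) (t) neq_st => [] [] // _ yi xi.
  have := xi (fun j lt_ji => f_equal _ (x0 j lt_ji)).
  have := yi (fun j lt_ji => etrans (esym (xy j (ltn_trans lt_ji lt_in))) (x0 j lt_ji)).
  by case: (x i).
have := xi x0.
have yi0 j : (j < i)%N -> signed true (y j) = T0.
  by move=> lt_ji; rewrite -xy ?x0 // (ltn_trans lt_ji).
by have := yi yi0; case: (x i).
Qed.

Lemma abs_word_agree n x y :
  agree n x y -> agree n (abs_word x) (abs_word y).
Proof.
have [x_pos [s eq_x]] := abs_wordP x; have [y_pos [t eq_y]] := abs_wordP y.
by move: x_pos y_pos; rewrite eq_x eq_y; apply: lex_le0_agree.
Qed.

Lemma abs_word_signed s x :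
  lex_le (cst T0) (signed_word s x) -> abs_word x = signed_word s x.
Proof.
have [x_pos [t eq_x]] := abs_wordP x; rewrite eq_x in x_pos * => sx_pos.
by apply: agree_eq => n; apply: lex_le0_agree.
Qed.

Lemma abs_signed_word s x : abs_word (signed_word s x) = abs_word x.
Proof.
have [x_pos [t eq_x]] := abs_wordP x; rewrite eq_x in x_pos *.
have eq_sx : signed_word t x = signed_word (t (+) s) (signed_word s x).
  by rewrite signed_wordD addbK.
by rewrite eq_sx; apply: abs_word_signed; rewrite -eq_sx.
Qed.

Lemma abs_word_head x s : x 0 = sgn s -> abs_word x = signed_word s x.
Proof.
move=> x0; apply: abs_word_signed; apply/lex_le0P => -[_|k /(_ 0 isT)].
  by rewrite /signed_word x0; case: (s).
by rewrite /signed_word x0; case: (s).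
Qed.

Lemma abs_shift_comp i j (x : word trit) :
  abs_word (shift j (abs_word (shift i x))) = abs_word (shift (i + j) x).
Proof.
have [_ [s ->]] := abs_wordP (shift i x).
by rewrite -shift_comp -(abs_signed_word s (shift j (shift i x))).
Qed.

Lemma abs_shift_agree j n (x y : word trit) :
  agree (j + n) x y -> agree n (abs_word (shift j x)) (abs_word (shift j y)).
Proof. by move=> /agree_shift /abs_word_agree. Qed.

Lemma Mset_absP le m : cylinder_order le ->
  Mset_abs le m <-> abs_word m = m /\ forall j, le (abs_word (shift j m)) m.
Proof. by move=> cyl; apply: (sup_orbitsP cyl abs_shift_comp abs_shift_agree). Qed.

Lemma seq_closed_Mset_abs le : cylinder_order le -> seq_closed (Mset_abs le).
Proof.
by move=> cyl; apply: (seq_closed_sup_orbits cyl abs_shift_comp abs_shift_agree).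
Qed.

(** * The four substitutions *)

Lemma substitutionsE :
  substitutions = range (fun p : pred bool => rho (count p)).
Proof.
have tauE : tau01 = rho (count pred0).
  apply/funext; elim/last_ind => [//|w x IHw].
  by rewrite rho_rcons -IHw /tau01 map_rcons flatten_rcons /rho_block count_pred0.
have rho2E : rho2 = rho (count predT).
  by congr rho; apply/funext => w; rewrite count_predT.
rewrite /substitutions rho2E tauE /rho0 /rho1; apply/seteqP; split.
  by move=> f [[[]|]|] ->; eexists.
move=> _ [p _ <-].
have eq_p : p =1 (fun x => if x then p true else p false) by case.
rewrite (_ : count p = count (fun x => if x then p true else p false)); last first.
  by apply/funext => w; apply: eq_count.
case: (p false) (p true) => [] [].
- by left; right; congr rho; apply/funext => w; apply: eq_count => -[].
- by left; left; left; congr rho; apply/funext => w; apply: eq_count => -[].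
- by left; left; right; congr rho; apply/funext => w; apply: eq_count => -[].
- by right; congr rho; apply/funext => w; apply: eq_count => -[].
Qed.

Section Sigma.
Variable p : pred bool.
Implicit Types (a b : word bool) (x : word trit).

Definition sigma a := extend (rho (count p)) a.

(** The block produced by the letter [a n] starts at position [pos a n] of
    [sigma a], with the sign [sign a n]. *)
Definition pos a n := n + count id (mkseq a n).
Definition sign a n := odd (count p (mkseq a n)).

Lemma posS a n : pos a n.+1 = (pos a n + a n).+1.
Proof. by rewrite /pos mkseqS -cats1 count_cat /= addn0 addSn addnA. Qed.

Lemma signS a n : sign a n.+1 = sign a n (+) p (a n).
Proof. by rewrite /sign mkseqS -cats1 count_cat /= addn0 oddD oddb. Qed.

Lemma ltn_pos a n m : (n < m)%N -> (pos a n < pos a m)%N.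
Proof.
elim: m => [//|m IHm]; rewrite ltnS leq_eqVlt posS ltnS.
move=> /predU1P[->|/IHm /ltnW le_nm]; first exact: leq_addr.
by apply: leq_trans le_nm (leq_addr _ _).
Qed.

Lemma pos_inj a : injective (pos a).
Proof.
by move=> n m eq_nm; case: (ltngtP n m) => // /(@ltn_pos a); rewrite eq_nm ltnn.
Qed.

Lemma leq_pos a n : n <= pos a n.
Proof. by rewrite leq_addr. Qed.

Lemma size_rho a n : size (rho (count p) (mkseq a n)) = pos a n.
Proof.
elim: n => [//|n IHn]; rewrite mkseqS rho_rcons size_cat IHn posS /rho_block.
by case: (a n); rewrite /= ?addn1 ?addn2 ?addn0.
Qed.

Lemma mkseq_sigma a n : mkseq (sigma a) (pos a n) = rho (count p) (mkseq a n).
Proof.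
by rewrite -size_rho extend_prefix // substitutionsE; exists p.
Qed.

Lemma sigma_block a n j : (j <= a n)%N ->
  sigma a (pos a n + j) = nth T0 (rho_block (count p) (mkseq a n) (a n)) j.
Proof.
move=> le_j; have lt_j : (pos a n + j < pos a n.+1)%N.
  by rewrite posS ltnS leq_add2l.
rewrite -(nth_mkseq T0 _ lt_j) mkseq_sigma mkseqS rho_rcons nth_cat size_rho.
by rewrite ltnNge leq_addr addKn.
Qed.

Lemma sigma_pos a n : sigma a (pos a n) = sgn (sign a n).
Proof.
rewrite -[pos a n]addn0 sigma_block // /rho_block /sign.
by case: (a n); case: odd.
Qed.

Lemma sigma_pos1 a n : (sigma a (pos a n).+1 == T0) = a n.
Proof.
have [an|an] := boolP (a n).
  by rewrite -addn1 sigma_block an // eqxx.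
have -> : (pos a n).+1 = pos a n.+1 by rewrite posS (negbTE an) addn0.
by rewrite sigma_pos sgn_eq0.
Qed.

Lemma posP a k : exists n, k = pos a n \/ a n /\ k = (pos a n).+1.
Proof.
elim: k => [|k [n [->|[an ->]]]]; first by exists 0; left.
  have [an|an] := boolP (a n); first by exists n; right.
  by exists n.+1; left; rewrite posS (negbTE an) addn0.
by exists n.+1; left; rewrite posS an addn1.
Qed.

(** Each position either starts a block or is the zero of a block, so that these
    letters determine the whole word. *)
Lemma sigma_unique a x : (forall n, x (pos a n) = sgn (sign a n)) ->
  (forall n, a n -> x (pos a n).+1 = T0) -> x = sigma a.
Proof.
move=> xs x0; apply/funext => k; have [n [->|[an ->]]] := posP a k.
  by rewrite xs sigma_pos.
by rewrite x0 //; apply/esym/eqP; rewrite sigma_pos1.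
Qed.

Lemma sigma0 a : sigma a 0 = T1.
Proof. exact: (sigma_pos a 0). Qed.

Lemma mkseqD a n m : mkseq a (n + m) = mkseq a n ++ mkseq (shift n a) m.
Proof.
rewrite /mkseq iotaD map_cat; congr (_ ++ _).
rewrite add0n -[X in iota X]addn0 iotaDl -map_comp.
by apply: eq_map => i.
Qed.

Lemma posD a n m : pos a (n + m) = pos a n + pos (shift n a) m.
Proof. by rewrite /pos mkseqD count_cat addnACA. Qed.

Lemma signD a n m : sign a (n + m) = sign a n (+) sign (shift n a) m.
Proof. by rewrite /sign mkseqD count_cat oddD. Qed.

(** Restarting at a block boundary only changes the initial sign, hence nothing
    once absolute values are taken. *)
Lemma shift_sigma a n :
  shift (pos a n) (sigma a) = signed_word (sign a n) (sigma (shift n a)).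
Proof.
rewrite -(@sigma_unique (shift n a)
  (signed_word (sign a n) (shift (pos a n) (sigma a)))).
- by rewrite signed_wordD addbb.
- move=> m; rewrite /signed_word /shift -posD sigma_pos signD /sgn signedD.
  by rewrite addKb.
- move=> m anm; apply/eqP; rewrite /signed_word signed_eq0 /shift addnS -posD.
  by rewrite sigma_pos1.
Qed.

Lemma abs_shift_sigma a n :
  abs_word (shift (pos a n) (sigma a)) = sigma (shift n a).
Proof.
by rewrite shift_sigma abs_signed_word (@abs_word_head _ false) ?sigma0.
Qed.

Lemma pos_agree n a b : agree n a b -> pos a n = pos b n.
Proof. by move=> /agree_mkseq ab; rewrite /pos ab. Qed.

(** Distinct letters [a n] and [b n] yield distinct letters of the images right
    after the position [pos a n]: a zero and a nonzero letter. *)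
Lemma sigma_agree n a b :
  agree n a b <-> agree (pos a n).+1 (sigma a) (sigma b).
Proof.
split=> [ab|]; last first.
  elim: n => [//|n IHn] ab; have {}IHn : agree n a b.
    by apply/IHn/(agree_le _ ab); rewrite posS !ltnS leqW // leq_addr.
  apply: agreeS => //; rewrite -!sigma_pos1 -(pos_agree IHn) ab //.
  by rewrite posS !ltnS leq_addr.
have eq_ab := (agree_mkseq n a b).1 ab; have eq_pos := pos_agree ab.
apply: agreeS; last by rewrite sigma_pos eq_pos sigma_pos /sign eq_ab.
by apply/agree_mkseq; rewrite mkseq_sigma eq_pos mkseq_sigma eq_ab.
Qed.

Lemma sigma_inj : injective sigma.
Proof. by move=> a b ab; apply: agree_eq => n; apply/sigma_agree; rewrite ab. Qed.

End Sigma.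

(** * Transfer of spectra along a substitution *)

(** The smallest letter is [sgn (p false)] after the word 1, and [sgn (p true)]
    after the word 10; the opposite letter is the greatest one after 1. *)
Definition adapted (p : pred bool) (le : rel (word trit)) : Prop :=
  [/\ forall a b, a 0 = T0 -> b 0 = T1 -> le a b,
      forall a b, a 0 = T1 -> b 0 = T1 -> a 1 <> b 1 ->
        a 1 = sgn (p false) \/ b 1 = sgn (~~ p false) -> le a b
    & forall a b, a 0 = T1 -> b 0 = T1 -> a 1 = T0 -> b 1 = T0 -> a 2 <> b 2 ->
        a 2 = sgn (p true) -> le a b].

Section Adapted.
Variables (le : rel (word trit)) (p : pred bool).
Hypothesis cyl : cylinder_order le.
Hypothesis le_p : adapted p le.

Definition pullback (a b : word bool) := le (sigma p a) (sigma p b).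

Lemma pullback_cylinder_order : cylinder_order pullback.
Proof.
apply: cylinder_order_agree.
- by move=> a b ab ba; apply: (@sigma_inj p); apply: (cyl_anti cyl).
- by move=> b a c; apply: (cyl_trans cyl).
- by move=> a b; apply/orP; apply: (cyl_total cyl).
move=> n a b c ab bc /(sigma_agree p) ac; apply/(sigma_agree p).
exact: (cyl_convex cyl ab bc).
Qed.

Lemma sigma_zero (a : word bool) : a 0 -> sigma p a 1 = T0.
Proof. by move=> a0; apply/eqP; rewrite (sigma_pos1 p a 0) a0. Qed.

Lemma sigma_after0 (a : word bool) : a 0 = false -> sigma p a 1 = sgn (p false).
Proof. by move=> a0; have := sigma_pos p a 1; rewrite posS signS a0. Qed.

Lemma sigma_after1 (a : word bool) : a 0 -> sigma p a 2 = sgn (p true).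
Proof. by move=> a0; have := sigma_pos p a 1; rewrite posS signS a0. Qed.

Lemma pullback_lt01 : strict pullback (cst false) (cst true).
Proof.
have [_ le1 _] := le_p; apply/andP; split.
  apply: le1; rewrite ?sigma0 //; rewrite sigma_after0 //; last by left.
  by rewrite sigma_zero //; apply/eqP; rewrite sgn_eq0.
by apply/eqP => /(congr1 (fun a : word bool => a 0)).
Qed.

(** A shift of [sigma p a] starts at a block, and then its absolute value is the
    image of a shift of [a], or at the zero of a block, and then it is below
    every word starting with 1. *)
Lemma Mset_pullback a : Mset pullback a <-> Mset_abs le (sigma p a).
Proof.
have [le0 _ _] := le_p.
apply: (iff_trans (MsetP pullback_cylinder_order a)).
apply: (iff_trans _ (iff_sym (Mset_absP _ cyl))); split=> [Ma|[_ Ma] j].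
  split=> [|k]; first exact: (abs_shift_sigma p a 0).
  have [n [->|[an ->]]] := posP a k; first by rewrite abs_shift_sigma; apply: Ma.
  apply: le0; last exact: sigma0.
  have [_ [s ->]] := abs_wordP (shift (pos a n).+1 (sigma p a)).
  by apply/eqP; rewrite signed_eq0 /shift addn0 sigma_pos1 an.
by rewrite /pullback -abs_shift_sigma.
Qed.

(** The two lowest ways of continuing an initial 1: these cylinders contain the
    whole image of [sigma p]. *)
Definition low (x : word trit) :=
  x 1 = sgn (p false) \/ x 1 = T0 /\ x 2 = sgn (p true).

Lemma sigma_low a : low (sigma p a).
Proof.
have [a0|/negbTE a0] := boolP (a 0); last by left; apply: sigma_after0.
by right; split; [apply: sigma_zero|apply: sigma_after1].
Qed.

Lemma low_agree (x y : word trit) : agree 3 x y -> low x -> low y.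
Proof. by move=> xy; rewrite /low !xy. Qed.

Lemma low_le (x y : word trit) :
  x 0 = T1 -> y 0 = T1 -> low x -> ~ low y -> le x y.
Proof.
have [_ le1 le2] := le_p; move=> x0 y0 low_x low_y.
have y1 : y 1 <> sgn (p false) by move=> y1; apply: low_y; left.
case: low_x => [x1|[x1 x2]]; first by apply: le1; rewrite ?x1; auto.
case: (trit_cases (p false) (y 1)) => [y1'|//|y1']; last first.
  apply: le1; rewrite ?x1 ?y1'; [by []|by []| |by right].
  by apply/eqP; rewrite eq_sym sgn_eq0.
apply: le2; rewrite ?x1 ?y1' //.
by rewrite x2 => y2; apply: low_y; right; rewrite y1' y2.
Qed.

Lemma low_closed (x y : word trit) :
  x 0 = T1 -> y 0 = T1 -> low y -> le x y -> low x.
Proof.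
move=> x0 y0 low_y le_xy; apply: contrapT => low_x; apply: (low_x).
by rewrite (cyl_anti cyl le_xy (low_le y0 x0 low_y low_x)).
Qed.

(** At every nonzero letter of [x], the absolute value of the shift is at most
    [x], which is low, hence it is low too. So after each nonzero letter of sign
    [s] comes either a letter of sign [s (+) p false], or a zero and then a
    letter of sign [s (+) p true]: these are the blocks of an image. *)
Lemma Mset_abs_low x : Mset_abs le x -> x 0 = T1 -> low x ->
  exists a, x = sigma p a.
Proof.
move=> /(Mset_absP _ cyl) [_ Mx] x0 low_x.
(* the nonzero letters of the word to be decoded: from k to the next one *)
pose next k := (k + (x k.+1 == T0)).+1.
have x_next k s : x k = sgn s ->
    x (next k) = sgn (s (+) p (x k.+1 == T0)).
  move=> xk; have abs_k : abs_word (shift k x) = signed_word s (shift k x).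
    by apply: abs_word_head; rewrite /shift addn0.
  have : low (signed_word s (shift k x)).
    apply: (low_closed _ x0 low_x); last by rewrite -abs_k.
    by rewrite /signed_word /shift addn0 xk; case: (s).
  have xE y t : signed s y = sgn t -> y = sgn (s (+) t).
    by rewrite /sgn -signedD => <-; rewrite signedD addbb.
  rewrite /low /signed_word /shift /next addn1 addn2.
  case=> [/xE xk1|[/eqP]]; first by rewrite xk1 sgn_eq0 addn0 xk1.
  by rewrite signed_eq0 => /eqP -> /xE; rewrite eqxx addn1.
pose q n := iter n next 0.
pose a n := x (q n).+1 == T0.
have qE n : q n = pos a n by elim: n => [//|n IHn]; rewrite posS -IHn.
have xq n : x (pos a n) = sgn (sign p a n).
  rewrite -qE; elim: n => [//|n IHn].
  by rewrite signS (x_next _ _ IHn).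
exists a; apply: sigma_unique => // n an.
by rewrite -qE; apply/eqP.
Qed.

(** A nonzero letter somewhere gives a shift whose absolute value starts with
    1, and which is at most [x]. *)
Lemma Mset_abs_head x : Mset_abs le x -> x <> cst T0 -> x 0 = T1.
Proof.
have [le0 _ _] := le_p; move=> /(Mset_absP _ cyl) [x_abs Mx] nz_x.
case: (trit_cases false (x 0)) => [x0| //|x0]; last first.
  have [/lex_le0P x_pos _] := abs_wordP x; rewrite x_abs in x_pos.
  by case: (x_pos 0).
have [k _ xk] := first_difference nz_x.
have abs_k : abs_word (shift k x) 0 = T1.
  rewrite (@abs_word_head _ (x k == Tm1)) /signed_word /shift addn0.
    by case: eqP xk => [-> //|]; case: (x k).
  exact: neq0_sgn.
suff eq_k : abs_word (shift k x) = x by rewrite -eq_k.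
by apply: (cyl_anti cyl) => //; apply: le0.
Qed.

Lemma limit_point_sigma a :
  limit_point (Mset pullback) a -> limit_point (Mset_abs le) (sigma p a).
Proof.
move=> /limit_point_agree lim_a; apply/limit_point_agree => n.
have [b [neq_ba Mb ab]] := lim_a n; exists (sigma p b); split.
- by move/sigma_inj.
- exact/Mset_pullback.
- by apply: agree_le ((sigma_agree p n a b).1 ab); rewrite leqW ?leq_pos.
Qed.

(** Words of the spectrum close to an image are low, hence are images too. *)
Lemma limit_point_sigma_inv a :
  limit_point (Mset_abs le) (sigma p a) -> limit_point (Mset pullback) a.
Proof.
move=> /limit_point_agree lim_a; apply/limit_point_agree => n.
have [y [neq_y My ay]] := lim_a (maxn 3 (pos a n).+1).
have y0 : y 0 = T1 by rewrite -ay ?leq_max ?sigma0.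
have low_y : low y.
  by apply: low_agree (sigma_low a); apply: agree_le ay; rewrite leq_maxl.
have [b eq_y] := Mset_abs_low My y0 low_y; rewrite {}eq_y in neq_y My ay *.
exists b; split=> [eq_ba||]; first by rewrite eq_ba in neq_y.
- exact/Mset_pullback.
- by apply/(sigma_agree p); apply: agree_le ay; rewrite leq_maxr.
Qed.

(** The word 0^oo is isolated in the spectrum, and the words that are not low
    are above all images, so the least accumulation point is an image. *)
Lemma mword_abs_pullback : mword_abs le = sigma p (mword pullback).
Proof.
have [lim m_min] := mwordP pullback_cylinder_order pullback_lt01.
apply: (least_eq cyl); first exact: limit_point_sigma.
move=> y lim_y; have near := (limit_point_agree _ _).1 lim_y.
have My : Mset_abs le y.
  by apply: (seq_closed_Mset_abs cyl) => n; have [z []] := near n; exists z.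
have y0 : y 0 = T1.
  apply: contrapT => ny0; have [z [neq_zy Mz yz]] := near 1.
  have eq0 x : Mset_abs le x -> x 0 <> T1 -> x = cst T0.
    by move=> Mx nx0; apply: contrapT => /(Mset_abs_head Mx).
  by apply: neq_zy; rewrite (eq0 y) // (eq0 z) // -(yz 0).
have [low_y|low_y] := pselect (low y); last first.
  exact: low_le (sigma0 _ _) y0 (sigma_low _) low_y.
have [b eq_y] := Mset_abs_low My y0 low_y; rewrite {}eq_y in lim_y *.
by apply: m_min; apply: limit_point_sigma_inv.
Qed.

Lemma Mset_abs_below :
  [set a | Mset_abs le a /\ strict le a (mword_abs le)]
  = [set cst T0] `|`
    [set sigma p a | a in
       [set a | Mset pullback a /\ strict pullback a (mword pullback)]].
Proof.
have [le0 _ _] := le_p; rewrite mword_abs_pullback; apply/seteqP; split=> x /=.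
  case=> Mx /andP[le_xm neq_xm].
  have [->|/(Mset_abs_head Mx) x0] := pselect (x = cst T0); [by left|right].
  have low_x : low x.
    by apply: low_closed (sigma_low (mword pullback)) _; rewrite ?sigma0.
  have [a eq_x] := Mset_abs_low Mx x0 low_x; rewrite {}eq_x in Mx le_xm neq_xm *.
  exists a => //; split; first exact/Mset_pullback.
  by apply/andP; split=> //; apply: contraNneq neq_xm => ->.
case=> [->|[a [Ma /andP[le_am neq_am]] <-]]; last first.
  split; first exact/Mset_pullback.
  apply/andP; split=> //; apply: contraNneq neq_am => eq_am.
  by apply/eqP; apply: sigma_inj eq_am.
split; last first.
  apply/andP; split; first by apply: le0; rewrite ?sigma0.
  apply/eqP => /(congr1 (fun x : word trit => x 0)).
  by rewrite sigma0.
apply/(Mset_absP _ cyl).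
have abs0 : abs_word (cst T0) = cst T0.
  by rewrite (@abs_word_signed false) //; apply/lex_le0P.
by split=> // j; rewrite abs0; apply: (cyl_refl cyl).
Qed.

End Adapted.

(** * The substitution attached to a consistent order *)

Lemma omega_rcons (w : seq trit) x :
  mkseq (omega (rcons w x)) (size w) = w /\ omega (rcons w x) (size w) = x.
Proof.
rewrite /omega size_rcons modn_small // nth_rcons ltnn eqxx; split=> //.
apply: (@eq_from_nth _ T0); rewrite size_mkseq // => i lt_i.
by rewrite nth_mkseq // modn_small ?nth_rcons ?lt_i // ltnW.
Qed.

Lemma sgn_cases (s : bool) (x y : trit) : x <> y ->
  x = sgn s \/ y = sgn (~~ s) ->
  [\/ x = sgn s /\ y = T0, x = T0 /\ y = sgn (~~ s) |
      x = sgn s /\ y = sgn (~~ s)].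
Proof.
move=> neq_xy [x_s|y_s].
  case: (trit_cases s y) => y_s; rewrite x_s y_s in neq_xy *; last 2 first.
  - by [].
  - by constructor 3.
  by constructor 1.
case: (trit_cases s x) => x_s; rewrite x_s y_s in neq_xy *; last 2 first.
- by constructor 3.
- by [].
by constructor 2.
Qed.

(** Consistency compares periodic words; by convexity of cylinders these can be
    replaced by arbitrary words with the same initial letters. *)
Lemma consistent_smallest le : cylinder_order le -> consistent le ->
  forall w, exists s, forall a b,
    mkseq a (size w) = w -> mkseq b (size w) = w -> a (size w) <> b (size w) ->
    a (size w) = sgn s \/ b (size w) = sgn (~~ s) -> le a b.
Proof.
move=> cyl cons w; have lt_le x y : cyl_lt le (rcons w x) (rcons w y) ->
    le (omega (rcons w x)) (omega (rcons w y)) by case/andP.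
have [s [le1 le2]] : exists s,
    le (omega (rcons w (sgn s))) (omega (rcons w T0)) /\
    le (omega (rcons w T0)) (omega (rcons w (sgn (~~ s)))).
  by case: (cons w) => -[/lt_le lt1 /lt_le lt2]; [exists true|exists false].
exists s => a b aw bw neq_ab ab.
have agree_omega c x : mkseq c (size w) = w -> c (size w) = x ->
    agree (size w).+1 (omega (rcons w x)) c.
  have [wx x_last] := omega_rcons w x; move=> cw cx; apply: agreeS.
    by apply/agree_mkseq; rewrite wx cw.
  by rewrite x_last cx.
suff : le (omega (rcons w (a (size w)))) (omega (rcons w (b (size w)))).
  by apply: (cyl_closed cyl neq_ab); apply: agree_omega.
case: (sgn_cases neq_ab ab) => -[-> ->] //.
exact: (cyl_trans cyl) le2.
Qed.

Lemma consistent_adapted le : cylinder_order le -> consistent le ->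
  strict le (cst T0) (cst T1) -> exists p, adapted p le.
Proof.
move=> cyl cons /andP[le01 neq01].
have [s1 le1] := consistent_smallest cyl cons [:: T1].
have [s2 le2] := consistent_smallest cyl cons [:: T1; T0].
exists (fun x => if x then s2 else s1).
split=> [a b a0 b0|a b a0 b0|a b a0 b0 a1 b1 neq2 a2].
- apply: (cyl_closed cyl (n := 0) _ _ _ le01); first by rewrite a0 b0.
  + by case.
  + by case.
- by apply: le1; rewrite /= /mkseq /= ?a0 ?b0.
- by apply: le2; rewrite /= /mkseq /= ?a0 ?b0 ?a1 ?b1 //; left.
Qed.

(** * Orders given by a direction after each finite word *)

Definition trit_lt (s : bool) (x y : trit) : bool :=
  if s then (trit_int y < trit_int x)%R else (trit_int x < trit_int y)%R.

Lemma trit_lt_trans s y x z : trit_lt s x y -> trit_lt s y z -> trit_lt s x z.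
Proof. by case: s; case: x; case: y; case: z. Qed.

Lemma trit_lt_total s x y : x <> y -> trit_lt s x y \/ trit_lt s y x.
Proof. by case: s; case: x; case: y => // _; first [by left|by right]. Qed.

Lemma trit_lt_asym s x y : trit_lt s x y -> trit_lt s y x -> False.
Proof. by case: s; case: x; case: y. Qed.

Lemma trit_lt_irr s x y : trit_lt s x y -> x <> y.
Proof. by case: s; case: x; case: y. Qed.

Lemma trit_lt_sgn s x y : x <> y ->
  x = sgn (~~ s) \/ y = sgn s -> trit_lt s x y.
Proof. by case: s; case: x; case: y => //= neq_xy []. Qed.

Section SignOrder.
Variable rev_at : seq trit -> bool.

(** The comparison is made at the first difference, with the direction attached
    to the common prefix. *)
Definition sign_lt (a b : word trit) : Prop := exists2 n,
  agree n a b & trit_lt (rev_at (mkseq a n)) (a n) (b n).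

Definition sign_le : rel (word trit) := fun a b => `[< a = b \/ sign_lt a b >].

Lemma sign_lt_diff n a b : agree n a b -> a n <> b n ->
  sign_lt a b <-> trit_lt (rev_at (mkseq a n)) (a n) (b n).
Proof.
move=> ab neq_n; split=> [[m ab_m lt_m]|lt_n]; last by exists n.
case: (ltngtP n m) => [lt_nm|lt_mn|->//].
  by case: neq_n; apply: ab_m.
by have := trit_lt_irr lt_m; rewrite ab.
Qed.

Lemma sign_le_diff n a b : agree n a b -> a n <> b n ->
  sign_le a b = trit_lt (rev_at (mkseq a n)) (a n) (b n).
Proof.
move=> ab neq_n; have lt_ab := sign_lt_diff ab neq_n.
apply/asboolP/idP => [[eq_ab|/lt_ab //]|/lt_ab]; last by right.
by case: neq_n; rewrite eq_ab.
Qed.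

Lemma sign_le_cylinder_order : cylinder_order sign_le.
Proof.
have anti a b : sign_le a b -> sign_le b a -> a = b.
  move=> le_ab le_ba; apply: contrapT => /first_difference[n ab neq_n].
  rewrite (sign_le_diff ab neq_n) in le_ab.
  rewrite (sign_le_diff (agree_sym ab) (nesym neq_n)) in le_ba.
  by rewrite -(agree_mkseq n a b).1 // in le_ba; apply: trit_lt_asym le_ab le_ba.
apply: cylinder_order_agree => [//|b a c|a b|n a b c].
- move=> /asboolP[->//|[n ab lt_ab]] /asboolP[<-|[m bc lt_bc]].
    by apply/asboolP; right; exists n.
  apply/asboolP; right; case: (ltngtP n m) => [lt_nm|lt_mn|eq_nm].
  + exists n; last by rewrite -bc.
    by apply: agree_trans ab _; apply: agree_le bc; apply: ltnW.
  + exists m; last first.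
      rewrite ab // (agree_mkseq m a b).1 //.
      by apply: agree_le ab; apply: ltnW.
    by apply: agree_trans _ bc; apply: agree_le ab; apply: ltnW.
  + rewrite -eq_nm in bc lt_bc; exists n; first exact: agree_trans ab bc.
    by apply: trit_lt_trans lt_ab _; rewrite (agree_mkseq n a b).1.
- have [->|/first_difference[n ab neq_n]] := pselect (a = b).
    by apply/orP; left; apply/asboolP; left.
  rewrite (sign_le_diff ab neq_n) (sign_le_diff (agree_sym ab) (nesym neq_n)).
  by rewrite -(agree_mkseq n a b).1 //; apply/orP; apply: trit_lt_total.
move=> le_ab le_bc ac; have [->//|/first_difference[k ab neq_k]] := pselect (a = b).
case: (leqP n k) => [le_nk|lt_kn]; first exact: agree_le ab.
have bc : agree k b c.
  by apply: agree_trans (agree_sym ab) _; apply: agree_le ac; apply: ltnW.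
have ack := ac _ lt_kn; rewrite (sign_le_diff ab neq_k) in le_ab.
rewrite (sign_le_diff bc) -?ack in le_bc; last exact: nesym.
rewrite -(agree_mkseq k a b).1 // in le_bc.
by case: (trit_lt_asym le_ab le_bc).
Qed.

Lemma sign_le_smallest w a b :
  mkseq a (size w) = w -> mkseq b (size w) = w -> a (size w) <> b (size w) ->
  a (size w) = sgn (~~ rev_at w) \/ b (size w) = sgn (rev_at w) -> sign_le a b.
Proof.
move=> aw bw neq_n ab.
rewrite (@sign_le_diff (size w)) ?aw //; last by apply/agree_mkseq; rewrite aw.
exact: trit_lt_sgn.
Qed.

Lemma sign_le_consistent : consistent sign_le.
Proof.
have cyl_ltE w x y : x <> y -> x = sgn (~~ rev_at w) \/ y = sgn (rev_at w) ->
    cyl_lt sign_le (rcons w x) (rcons w y).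
  move=> neq_xy xy; have [[wx x_last] [wy y_last]] := (omega_rcons w x, omega_rcons w y).
  apply/andP; split; first by apply: sign_le_smallest wx wy _ _; rewrite x_last y_last.
  by apply/eqP => /(congr1 (fun a : word trit => a (size w))); rewrite x_last y_last.
move=> w; case E : (rev_at w); [right|left].
  by split; apply: cyl_ltE; rewrite ?E; auto.
by split; apply: cyl_ltE; rewrite ?E; auto.
Qed.

End SignOrder.

(** * Prescribing an order on the image of a substitution *)

Section Extension.
Variables (p : pred bool) (prec : rel (word bool)).
Hypothesis cyl : cylinder_order prec.
Hypothesis prec01 : strict prec (cst false) (cst true).

(** The word [u] is the longest common prefix of the images of [a] and [b], whose
    first difference is at [n]. *)
Definition split_at (u : seq trit) (a b : word bool) n :=
  [/\ agree n a b, a n = false, b n = true & u = mkseq (sigma p a) (pos a n).+1].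

(** After [u], the image of [a] continues with the letter of sign
    [sign p a n.+1] and the image of [b] with 0, so the letters have to be
    reversed if and only if this letter is 1 and [a] is smaller, or it is -1 and
    [a] is greater. The word 10 never is such a common prefix, as it ends with a
    zero; its direction is dictated by the intended [p true]. *)
Definition extension_rev (u : seq trit) : bool :=
  (u == [:: T1; T0]) && ~~ p true ||
  `[< exists a b n, split_at u a b n /\ prec a b != sign p a n.+1 >].

Definition extension_order := sign_le extension_rev.

(** The prefix [u] can be decoded: it determines the common prefix of [a] and
    [b], hence the comparison of [a] and [b] in any cylinder order. *)
Lemma split_at_agree u a b n a' b' n' :
  split_at u a b n -> split_at u a' b' n' -> agree n a a' /\ n = n'.
Proof.
move=> [_ _ _ eq_u] [_ _ _ eq_u'].
have eq_pos : pos a n = pos a' n'.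
  by have := congr1 size eq_u'; rewrite eq_u !size_mkseq => -[].
have aa' : agree n a a'.
  by apply/(sigma_agree p)/agree_mkseq; rewrite -eq_u eq_pos.
by split=> //; apply: (@pos_inj a'); rewrite -(pos_agree aa').
Qed.

Lemma split_at_prec u a b n a' b' n' : split_at u a b n -> split_at u a' b' n' ->
  prec a b = prec a' b'.
Proof.
move=> u_ab u_ab'; have [aa' eq_n] := split_at_agree u_ab u_ab'.
case: u_ab u_ab' => [ab an bn _] [ab' an' bn' _].
rewrite -{}eq_n in ab' an' bn' *.
have aa1 : agree n.+1 a a' by apply: agreeS => //; rewrite an an'.
have bb1 : agree n.+1 b b'.
  apply: agreeS; last by rewrite bn bn'.
  exact: agree_trans (agree_sym ab) (agree_trans aa' ab').
have nab : ~ agree n.+1 a b by move=> /(_ n (ltnSn n)); rewrite an bn.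
have nab' : ~ agree n.+1 a' b' by move=> /(_ n (ltnSn n)); rewrite an' bn'.
by apply/idP/idP; apply: (cyl_agree cyl (n := n.+1)) => //; apply: agree_sym.
Qed.

Lemma split_at_last u a b n : split_at u a b n -> last T0 u <> T0.
Proof.
case=> _ _ _ ->; rewrite mkseqS last_rcons sigma_pos.
by apply/eqP; rewrite sgn_eq0.
Qed.

Lemma extension_rev_split u a b n : split_at u a b n ->
  extension_rev u = (prec a b != sign p a n.+1).
Proof.
move=> u_ab; rewrite /extension_rev; case: eqP => [eq_u|_] /=.
  by have := split_at_last u_ab; rewrite eq_u.
apply/asboolP/idP => [[a' [b' [n' [u_ab' neq]]]]|neq]; last by exists a, b, n.
have [aa' eq_n] := split_at_agree u_ab u_ab'; rewrite -eq_n in u_ab' neq.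
rewrite (split_at_prec u_ab u_ab') (_ : sign p a n.+1 = sign p a' n.+1) //.
case: u_ab u_ab' => _ an _ _ [_ an' _ _].
by rewrite !signS an an' /sign (agree_mkseq n a a').1.
Qed.

Lemma pullback_extension_diff n a b : agree n a b -> a n = false -> b n = true ->
  pullback extension_order p a b = prec a b.
Proof.
move=> ab an bn; pose u := mkseq (sigma p a) (pos a n).+1.
have u_ab : split_at u a b n by [].
have a_next : sigma p a (pos a n).+1 = sgn (sign p a n.+1).
  by rewrite -sigma_pos posS an addn0.
have b_next : sigma p b (pos a n).+1 = T0.
  by rewrite (pos_agree ab); apply/eqP; rewrite sigma_pos1.
rewrite /pullback /extension_order.
rewrite (@sign_le_diff _ (pos a n).+1).
- rewrite (extension_rev_split u_ab) a_next b_next.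
  by case: (prec a b); case: (sign _ _ _).
- exact/sigma_agree.
- by rewrite a_next b_next; apply/eqP; rewrite sgn_eq0.
Qed.

Lemma extension_cylinder_order : cylinder_order extension_order.
Proof. exact: sign_le_cylinder_order. Qed.

Lemma pullback_extension : pullback extension_order p = prec.
Proof.
have ext_cyl := extension_cylinder_order.
have pull_cyl := pullback_cylinder_order p ext_cyl.
apply/funext => a; apply/funext => b.
have [<-|neq_ab] := pselect (a = b).
  by rewrite (cyl_refl pull_cyl) (cyl_refl cyl).
have [n ab neq_n] := first_difference neq_ab.
have [an|an] := boolP (a n).
  rewrite (cyl_negb pull_cyl neq_ab) (cyl_negb cyl neq_ab).
  rewrite (pullback_extension_diff (agree_sym ab)) //.
  by apply/negbTE/negP => bn; rewrite an bn in neq_n.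
apply: (pullback_extension_diff ab); first exact/negbTE.
by apply/negPn/negP => bn; rewrite (negbTE an) (negbTE bn) in neq_n.
Qed.

(** The direction after 1 is the one prescribed by 0^oo < 1^oo. *)
Lemma extension_adapted : adapted p extension_order.
Proof.
have rev0 : extension_rev [::] = false.
  rewrite /extension_rev /=; apply/asboolP => -[a [b [n [u_ab _]]]].
  by have := split_at_last u_ab.
have rev1 : extension_rev [:: T1] = ~~ p false.
  have u01 : split_at [:: T1] (cst false) (cst true) 0.
    by split=> //; rewrite /mkseq /= sigma0.
  have /andP[prec_01 _] := prec01.
  by rewrite (extension_rev_split u01) prec_01 signS.
have rev2 : extension_rev [:: T1; T0] = ~~ p true.
  rewrite /extension_rev eqxx /=; apply/orb_idr => /asboolP.
  by move=> -[a [b [n [u_ab _]]]]; have := split_at_last u_ab.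
split=> [a b a0 b0|a b a0 b0 neq1 ab1|a b a0 b0 a1 b1 neq2 a2].
- by apply: (@sign_le_smallest _ [::]); rewrite /= ?rev0 ?a0 ?b0 //; right.
- apply: (@sign_le_smallest _ [:: T1]); rewrite /mkseq /= ?a0 ?b0 //.
  by rewrite rev1 negbK.
- apply: (@sign_le_smallest _ [:: T1; T0]); rewrite /mkseq /= ?a0 ?b0 ?a1 ?b1 //.
  by rewrite rev2 negbK; left.
Qed.

Lemma extension_lt01 : strict extension_order (cst T0) (cst T1).
Proof.
have [le0 _ _] := extension_adapted; apply/andP; split; first exact: le0.
by apply/eqP => /(congr1 (fun a : word trit => a 0)).
Qed.

End Extension.

(** The image of a word starting with 10 starts with a letter 1, a zero, and the
    letters of signs [p true] and [p true (+) p false]. *)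
Lemma sigma_determines p p' (a a' : word bool) : a 0 = true -> a 1 = false ->
  a' 0 = true -> a' 1 = false -> sigma p a = sigma p' a' -> p = p'.
Proof.
have sigma3 q (b : word bool) : b 0 = true -> b 1 = false ->
    sigma q b 3 = sgn (q true (+) q false).
  by move=> b0 b1; have := sigma_pos q b 2; rewrite !posS !signS b0 b1.
move=> a0 a1 a'0 a'1 eq_s.
have eq_t : p true = p' true.
  apply: sgn_inj; rewrite -(sigma_after1 p (a := a)) //.
  by rewrite eq_s sigma_after1.
apply/funext => -[//|]; apply: (@addbI (p true)); rewrite {2}eq_t.
by apply: sgn_inj; rewrite -(sigma3 p a) // -(sigma3 p' a') // eq_s.
Qed.

Theorem theorem8 :
  (forall m : word trit,
     (exists le : rel (word trit),
        [/\ cylinder_order le, consistent le,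
            strict le (cst T0) (cst T1) & m = mword_abs le])
     <->
     (exists (sigma : seq bool -> seq trit) (prec : rel (word bool)),
        [/\ substitutions sigma, cylinder_order prec,
            strict prec (cst false) (cst true) &
            m = extend sigma (mword prec)]))
  /\
  (forall le : rel (word trit),
     cylinder_order le -> consistent le -> strict le (cst T0) (cst T1) ->
   forall sigma : seq bool -> seq trit, substitutions sigma ->
     (exists prec : rel (word bool),
        [/\ cylinder_order prec, strict prec (cst false) (cst true) &
            mword_abs le = extend sigma (mword prec)]) ->
   let prec : rel (word bool) :=
     fun a b => le (extend sigma a) (extend sigma b) in
     [/\ cylinder_order prec,
         strict prec (cst false) (cst true),
         mword_abs le = extend sigma (mword prec) &
         [set a | Mset_abs le a /\ strict le a (mword_abs le)]
         = [set cst T0] `|`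
           [set extend sigma a | a in
              [set a | Mset prec a /\ strict prec a (mword prec)]]]).
Proof.
split=> [m|le cyl cons lt01 f]; first split.
- case=> le [cyl cons lt01 ->].
  have [p le_p] := consistent_adapted cyl cons lt01.
  exists (rho (count p)), (pullback le p); split.
  + by rewrite substitutionsE; exists p.
  + exact: pullback_cylinder_order.
  + exact: pullback_lt01.
  + exact: mword_abs_pullback.
- case=> f [prec []]; rewrite substitutionsE => -[p _ <-] cyl prec01 ->.
  have ext_cyl := extension_cylinder_order p prec.
  have ext_p := extension_adapted p cyl prec01.
  exists (extension_order p prec); split=> //.
  + exact: sign_le_consistent.
  + exact: extension_lt01.
  + by rewrite (mword_abs_pullback ext_cyl ext_p) (pullback_extension p cyl).
rewrite substitutionsE => -[p _ <-] [prec' [cyl' lt01' eq_m]] prec.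
have [p' le_p'] := consistent_adapted cyl cons lt01.
have [m0 m1] := mword_head cyl' lt01'.
have [m0' m1'] := mword_head (pullback_cylinder_order p' cyl) (pullback_lt01 le_p').
have eq_p : p = p'.
  apply: sigma_determines m0 m1 m0' m1' _.
  by rewrite -mword_abs_pullback.
rewrite -{}eq_p in le_p'; split.
- exact: pullback_cylinder_order.
- exact: pullback_lt01.
- exact: mword_abs_pullback.
- exact: Mset_abs_below.
Qed.
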